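(* $\mathfrak{L}(SL(2,\mathbb{Z})) \subsetneq \mathfrak{L}(SL(3,\mathbb{Z}))$.
   Context: For a group $G$ with identity $e$, a $G$-automaton is a tuple $(Q,\Sigma,G,\delta,q_0,Q_a)$ where $Q$ is a finite set of states, $\Sigma$ a finite input alphabet, $q_0\in Q$ the initial state, $Q_a\subseteq Q$ the accepting states, and $\delta$ assigns to each $(q,\sigma)\in Q\times(\Sigma\cup\{\varepsilon\})$ a finite set of pairs $(q',m)\in Q\times G$. The register holds an element of $G$, initially $e$; using a transition $(q',m)\in\delta(q,\sigma)$ the automaton reads $\sigma$ (or nothing if $\sigma=\varepsilon$), moves to $q'$ and replaces the register content $x$ by $xm$. A word is accepted if some computation reads it entirely and ends in an accepting state with register equal to $e$. $\mathfrak{L}(G)$ is the class of languages recognized by $G$-automata. $SL(n,\mathbb{Z})$ is the group of $n\times n$ integer matrices of determinant $1$. *)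

(* Defs.v *)
From Stdlib Require List.
From mathcomp Require Import all_boot all_algebra.
Set Implicit Arguments. Unset Strict Implicit. Unset Printing Implicit Defensive.
Import GRing.Theory.
Local Open Scope ring_scope.

(* A G-automaton over the input alphabet Sigma.  The group G is presented by
   a carrier type [T], a predicate [inG] cutting out G inside T, the group
   multiplication [mul] and the identity [e].  States form a finite type;
   the transition function assigns to every (state, letter-or-epsilon) a
   finite list of (next state, group element) pairs ([None] = epsilon). *)
Record gaut (T : Type) (Sigma : Type) := GAut {
  gstate : finType;
  gdelta : gstate -> option Sigma -> seq (gstate * T);
  gq0 : gstate;
  gacc : pred gstate }.
Arguments gstate {T Sigma} g.
Arguments gdelta {T Sigma} g _ _.
Arguments gq0 {T Sigma} g.
Arguments gacc {T Sigma} g _.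

Section Runs.
Variables (T : Type) (mul : T -> T -> T) (Sigma : Type) (A : gaut T Sigma).

Inductive reaches : gstate A -> T -> seq Sigma -> gstate A -> T -> Prop :=
| reaches_nil q x : reaches q x [::] q x
| reaches_eps q x w q1 m q2 y :
    List.In (q1, m) (gdelta A q None) -> reaches q1 (mul x m) w q2 y ->
    reaches q x w q2 y
| reaches_read q x a w q1 m q2 y :
    List.In (q1, m) (gdelta A q (Some a)) -> reaches q1 (mul x m) w q2 y ->
    reaches q x (a :: w) q2 y.

Definition gaccepts (e : T) (w : seq Sigma) : Prop :=
  exists qf : gstate A, gacc A qf /\ reaches (gq0 A) e w qf e.
End Runs.

Definition gaut_over (T : Type) (inG : T -> Prop) (Sigma : Type)
  (A : gaut T Sigma) : Prop :=
  forall (q : gstate A) (s : option Sigma) (p : gstate A * T), List.In p (gdelta A q s) -> inG p.2.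

Definition in_frakL (T : Type) (inG : T -> Prop) (mul : T -> T -> T) (e : T)
  (Sigma : Type) (L : seq Sigma -> Prop) : Prop :=
  exists A : gaut T Sigma, gaut_over inG A /\
    forall w, L w <-> gaccepts mul A e w.

Definition inSL (n : nat) (M : 'M[int]_n) : Prop := \det M = 1.

Definition in_frakL_SL (n : nat) (Sigma : finType) (L : seq Sigma -> Prop) :=
  @in_frakL 'M[int]_n (@inSL n) (@mulmx int n n n) (1%:M) Sigma L.

(* Main.v *)
(* SL(2,Z) is generated by S, of order 4, and R, of order 6, and a product of
   elements of B = <S> u <R> which is 1 always has two neighbouring factors
   whose product is again in B: otherwise the factors alternate between
   <S> \ {1, -1} and <R> \ {1, -1}, and sign patterns show that such an
   alternating product is not 1. Contracting neighbours repeatedly turns an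
   accepting run of an SL(2,Z)-automaton into a binary derivation tree with
   nonterminals (p, b, q), for "a run from p to q multiplies the register by b
   in B". There are finitely many of them, so unary languages of
   SL(2,Z)-automata satisfy a pumping lemma.

   SL(3,Z) contains the Heisenberg group, in which J^k = E23^k E13^C(k,2) E12^k
   for J = [[1,1,0],[0,1,1],[0,0,1]]. An automaton multiplying by J^k E12^-i
   E13^-n E23^-m, and reading a letter at each E13^-1, accepts a^n exactly when
   n = C(k,2) for some k; this set contains no infinite arithmetic progression. *)
Require Import Defs.
From mathcomp Require Import all_boot all_algebra.
From mathcomp Require Import zify ring.
Set Implicit Arguments. Unset Strict Implicit. Unset Printing Implicit Defensive.
Import GRing.Theory.

(** * Runs, and transport of automata along injective morphisms *)

Lemma reaches_cat (T : Type) (mul : T -> T -> T) (Sigma : Type) (A : gaut T Sigma)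
    p x v q y w r z :
  @reaches T mul Sigma A p x v q y -> reaches mul q y w r z ->
  reaches mul p x (v ++ w) r z.
Proof.
elim=> {p x v q y} // [p x v p' m q y Hd _ IH|p x a v p' m q y Hd _ IH] /IH Hr.
  exact: reaches_eps Hd Hr.
exact: reaches_read Hd Hr.
Qed.

Lemma In_map (T T' : Type) (f : T -> T') s y :
  List.In y (map f s) <-> exists x, f x = y /\ List.In x s.
Proof. exact: List.in_map_iff. Qed.

Section Transfer.
Variables (T T' : Type) (mul : T -> T -> T) (mul' : T' -> T' -> T').
Variable phi : T -> T'.
Hypothesis phiM : forall x y, phi (mul x y) = mul' (phi x) (phi y).
Variables (Sigma : Type) (A : gaut T Sigma).

Definition gaut_map : gaut T' Sigma :=
  @GAut T' Sigma (gstate A)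
    (fun q s => [seq (p.1, phi p.2) | p <- gdelta A q s]) (gq0 A) (gacc A).

Lemma reaches_map q x w r y :
  @reaches T mul Sigma A q x w r y ->
  @reaches T' mul' Sigma gaut_map q (phi x) w r (phi y).
Proof.
elim=> {q x w r y} [q x|q x w q1 m q2 y Hd _ IH|q x a w q1 m q2 y Hd _ IH].
- exact: reaches_nil.
- apply: (@reaches_eps _ _ _ gaut_map _ _ _ q1 (phi m)); last by rewrite -phiM.
  by apply/In_map; exists (q1, m).
- apply: (@reaches_read _ _ _ gaut_map _ _ _ _ q1 (phi m)); last by rewrite -phiM.
  by apply/In_map; exists (q1, m).
Qed.

Lemma reaches_map_inv q x' w r y' :
  @reaches T' mul' Sigma gaut_map q x' w r y' -> forall x, x' = phi x ->
  exists y, y' = phi y /\ @reaches T mul Sigma A q x w r y.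
Proof.
elim=> {q x' w r y'} [q x'|q x' w q1 m' q2 y' Hd _ IH|q x' a w q1 m' q2 y' Hd _ IH] x ex.
- by exists x; split=> //; exact: reaches_nil.
- case/In_map: Hd => [[q3 m] [[e1 e2] Hin]]; subst.
  have [y [ey Hr]] := IH _ (esym (phiM _ _)).
  by exists y; split=> //; exact: reaches_eps Hin Hr.
- case/In_map: Hd => [[q3 m] [[e1 e2] Hin]]; subst.
  have [y [ey Hr]] := IH _ (esym (phiM _ _)).
  by exists y; split=> //; exact: reaches_read Hin Hr.
Qed.

End Transfer.

(** Applying [phi] to every transition label transports runs in both directions; injectivity ensures
    that the image register is back at [e'] only when the original one is back at [e]. *)
Lemma in_frakL_morph (T T' : Type) (inG : T -> Prop) (inG' : T' -> Prop)
    (mul : T -> T -> T) (mul' : T' -> T' -> T') e e' (phi : T -> T')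
    (Sigma : Type) (L : seq Sigma -> Prop) :
  injective phi -> (forall x y, phi (mul x y) = mul' (phi x) (phi y)) ->
  phi e = e' -> (forall x, inG x -> inG' (phi x)) ->
  in_frakL inG mul e L -> in_frakL inG' mul' e' L.
Proof.
move=> phi_inj phiM phie phiG [A [HA HL]]; exists (gaut_map phi A); split.
  by move=> q s p /In_map[p0 [<- /HA Hp]] /=; exact: phiG.
move=> w; rewrite HL; split=> -[qf [Hacc Hr]]; exists qf; split=> //.
  by rewrite -phie; exact: reaches_map.
have [y [ey Hy]] := reaches_map_inv phiM Hr (esym phie).
by rewrite -phie in ey; rewrite [X in reaches _ _ _ _ _ X](phi_inj _ _ ey).
Qed.

(** * Pumping in binary derivation trees *)

Section Pumping.
Variables (X : eqType) (N : seq X).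
Variables (leaf : X -> nat -> Prop) (rule : X -> X -> X -> Prop).
Hypothesis leaf_le1 : forall x n, leaf x n -> n <= 1.

Inductive der : X -> nat -> Prop :=
| der_leaf x n : leaf x n -> der x n
| der_node x y z n m :
    x \in N -> rule x y z -> der y n -> der z m -> der x (n + m).

(** A derivation tree of [x] with a hole for [y] and [k] letters outside the hole, encoded by its
    effect so that contexts compose like functions. *)
Definition ctx x y k := forall n, der y n -> der x (k + n).

(* [V] collects the nonterminals already met between [x0] and [x]. *)
Lemma pumping_aux x0 n0 x n : der x n -> forall (V : seq X) j,
  uniq V -> {subset V <= N} ->
  ctx x0 x j -> n0 = j + n ->
  (forall v, v \in V -> exists j k, [/\ ctx x0 v j, ctx v x k, 0 < k & n0 = j + k + n]) ->
  2 ^ (size N - size V) < n ->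
  exists k, 0 < k /\ forall t, der x0 (n0 + t * k).
Proof.
elim=> {x n} [x n /leaf_le1 n1|x y z n m xN Hr Dy IHy Dz IHz] V j uV sV cx en0 HV Hn.
  by have := expn_gt0 2 (size N - size V); lia.
have ctxy : ctx x y m.
  by move=> l Dl; rewrite addnC; exact: der_node Hr Dl Dz.
have ctxz : ctx x z n.
  by move=> l Dl; exact: der_node Hr Dy Dl.
have ctx_comp a b c k l : ctx a b k -> ctx b c l -> ctx a c (k + l).
  by move=> H1 H2 r Dr; rewrite -addnA; apply: H1; apply: H2.
have IHy0 := IHy V (j + m) uV sV (ctx_comp _ _ _ _ _ cx ctxy).
have IHz0 := IHz V (j + n) uV sV (ctx_comp _ _ _ _ _ cx ctxz).
(* A node with a child of yield 0 is not recorded in [V]: its context to the other child has length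
   0, whereas the contexts kept for [V] must have positive length. *)
case: (posnP n) => [n0E|n_gt0].
  apply: IHz0; try lia.
  move=> v /HV[i [k [c1 c2 k_gt0 E]]]; exists i, (k + n); split=> //; try lia.
  exact: ctx_comp c2 ctxz.
case: (posnP m) => [m0E|m_gt0].
  apply: IHy0; try lia.
  move=> v /HV[i [k [c1 c2 k_gt0 E]]]; exists i, (k + m); split=> //; try lia.
  exact: ctx_comp c2 ctxy.
(* If [x] was met before, the context from [x] to itself has positive length and can be iterated. *)
case: (boolP (x \in V)) => [/HV[i [k [c1 c2 k_gt0 E]]]|xV].
  exists k; split=> // t.
  have Dt : der x (t * k + (n + m)).
    elim: t => [|t IH]; first by rewrite add0n; exact: der_node Hr Dy Dz.
    by rewrite mulSn -addnA; exact: c2.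
  have -> : n0 + t * k = i + (k + (t * k + (n + m))) by lia.
  by apply: c1; apply: c2.
have uV' : uniq (x :: V) by rewrite /= xV.
have sV' : {subset x :: V <= N} by move=> v /predU1P[->|/sV].
have szV : size V < size N by exact: uniq_leq_size uV' sV'.
have HV' w k l : ctx x w k -> 0 < k -> n + m = k + l -> forall v, v \in x :: V ->
    exists j' k', [/\ ctx x0 v j', ctx v w k', 0 < k' & n0 = j' + k' + l].
  move=> cw k_gt0 E v /predU1P[->|/HV[i [k' [c1 c2 k'_gt0 E']]]].
    by exists j, k; split=> //; lia.
  exists i, (k' + k); split=> //; try lia.
  exact: ctx_comp c2 cw.
have szE : size N - size V = (size N - size (x :: V)).+1 by rewrite /=; lia.
rewrite szE expnS in Hn.
(* Recording [x] halves the threshold, so one of the two children still has a yield above it. *)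
case: (ltnP (2 ^ (size N - size (x :: V))) n) => [lt|ge].
  apply: (IHy (x :: V) (j + m)) => //; [exact: ctx_comp cx ctxy|lia|].
  by apply: HV' ctxy m_gt0 _; lia.
apply: (IHz (x :: V) (j + n)) => //; [exact: ctx_comp cx ctxz|lia| |lia].
exact: HV' ctxz n_gt0 _.
Qed.

Lemma pumping x n : der x n -> 2 ^ size N < n ->
  exists k, 0 < k /\ forall t, der x (n + t * k).
Proof.
move=> Dx Hn; apply: (pumping_aux (x0 := x) (j := 0) Dx (V := [::])) => //.
by rewrite subn0.
Qed.

End Pumping.

Section Contraction.
Variables (T : eqType) (mul : T -> T -> T) (e : T).
Hypotheses (mulA : associative mul) (mul1 : left_id e mul).
Variable B : seq T.

Definition gprod (l : seq T) : T := foldr mul e l.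

Lemma gprod_cat l1 l2 : gprod (l1 ++ l2) = mul (gprod l1) (gprod l2).
Proof. by elim: l1 => [|b l1 IH] /=; rewrite ?mul1 // IH mulA. Qed.

Definition contractible :=
  forall l, {subset l <= B} -> 1 < size l -> gprod l = e ->
  exists l1 b b' l2, l = l1 ++ [:: b, b' & l2] /\ mul b b' \in B.

End Contraction.

(** * Parsing runs by contraction *)

Section UnaryPumping.
Variables (T : eqType) (mul : T -> T -> T) (e : T).
Hypotheses (mulA : associative mul) (mul1 : left_id e mul) (mulr1 : right_id e mul).
Variable B : seq T.
Hypothesis Bcontr : contractible mul e B.
Variable A : gaut T unit.

Notation gp := (gprod mul e).
(* A pair (q, u) stands for the state q with a register that still has to be
   multiplied by the factors in u. *)
Notation X := ((gstate A * seq T) * T * (gstate A * seq T))%type.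

(** The pending words. Closure under tails allows factors to be consumed one at a time; finiteness
    of [U] keeps the set of nonterminals finite. *)
Variable U : seq (seq T).
Hypothesis U0 : [::] \in U.
Hypothesis Ucons : forall b u, b :: u \in U -> b \in B /\ u \in U.
Hypothesis Ufact : forall q s q' m, List.In (q', m) (gdelta A q s) ->
  exists u, u \in U /\ gp u = m.

Definition tri_nonterm : seq X :=
  let E := [seq (q, u) | q <- enum (gstate A), u <- U] in
  [seq (x, p) | x <- [seq (p, b) | p <- E, b <- B], p <- E].

Lemma tri_nontermP (p : gstate A * seq T) b (q : gstate A * seq T) :
  p.2 \in U -> b \in B -> q.2 \in U -> (p, b, q) \in tri_nonterm.
Proof.
case: p q => [p u] [q v] hu hb hv.
by apply: allpairs_f; [apply: allpairs_f => //|]; apply: allpairs_f => //;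
  rewrite mem_enum.
Qed.

(** A transition is split into one push, which reads the letter and loads a factorization of [m]
    while contributing only [e], and pops contributing one factor each. Hence every leaf has yield
    at most 1. *)
Inductive tri_leaf : X -> nat -> Prop :=
| tri_push q s q' m u : List.In (q', m) (gdelta A q s) -> u \in U -> gp u = m ->
    tri_leaf ((q, [::]), e, (q', u)) (s != None)
| tri_pop q b u : b :: u \in U -> tri_leaf ((q, b :: u), b, (q, u)) 0.

Inductive tri_rule : X -> X -> X -> Prop :=
| tri_split p b r b' q : tri_rule (p, mul b b', q) (p, b, r) (r, b', q).

Notation tri := (der tri_nonterm tri_leaf tri_rule).

(** A pair [(q, u)] with partial product [g] represents the actual register [g * gp u]: a push
    multiplies it by [m], a pop leaves it unchanged. The start [g] is arbitrary because the second
    half of a split starts at [g * b]. *)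
Lemma tri_reaches x n : tri x n -> forall g,
  reaches mul x.1.1.1 (mul g (gp x.1.1.2)) (nseq n tt)
    x.2.1 (mul (mul g x.1.2) (gp x.2.2)).
Proof.
elim=> {x n} [x n|x y z n m _ [p b r b' q] _ IH1 _ IH2 g].
  case=> {x n} [q s q' m u Hd _ Hm|q b u _] g /=; last first.
    by rewrite mulA; exact: reaches_nil.
  rewrite !mulr1 Hm; case: s Hd => [[]|] Hd.
    by apply: reaches_read Hd _; exact: reaches_nil.
  by apply: reaches_eps Hd _; exact: reaches_nil.
by rewrite nseqD; apply: reaches_cat (IH1 g) _; have /= := IH2 (mul g b); rewrite !mulA.
Qed.

Inductive tri_chain : gstate A * seq T -> seq T -> gstate A * seq T -> nat -> Prop :=
| tri_chain_nil p : tri_chain p [::] p 0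
| tri_chain_cons p b r l q n m : p.2 \in U -> r.2 \in U -> b \in B ->
    tri (p, b, r) n -> tri_chain r l q m -> tri_chain p (b :: l) q (n + m).

Lemma tri_chain_cat p l r n l' q m :
  tri_chain p l r n -> tri_chain r l' q m -> tri_chain p (l ++ l') q (n + m).
Proof.
elim=> {p l r n} // p b r l q' n k Up Ur Bb D _ IH /IH h.
by rewrite -addnA; exact: tri_chain_cons h.
Qed.

Lemma tri_chain_factor q u : u \in U -> tri_chain (q, u) u (q, [::]) 0.
Proof.
elim: u => [|b u IH] hu; first exact: tri_chain_nil.
have [hb hu'] := Ucons hu.
apply: (@tri_chain_cons _ _ (q, u) _ _ 0 0) => //; last exact: IH.
exact/der_leaf/tri_pop.
Qed.

Lemma tri_chain_step q s q' m : e \in B -> List.In (q', m) (gdelta A q s) ->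
  exists l, tri_chain (q, [::]) l (q', [::]) (s != None) /\ gp l = m.
Proof.
(* The leading [e] is the contribution of the push; the pops contribute [u]. *)
move=> eB Hd; have [u [Uu pu]] := Ufact Hd; exists (e :: u).
split; last by rewrite /= mul1.
rewrite -[(_ != _ : nat)]addn0.
apply: (@tri_chain_cons _ _ (q', u)) => //; last exact: tri_chain_factor.
exact/der_leaf/(tri_push Hd Uu pu).
Qed.

Lemma reaches_tri_chain q x w q' y : e \in B -> reaches mul q x w q' y ->
  exists l, tri_chain (q, [::]) l (q', [::]) (size w) /\ y = mul x (gp l).
Proof.
move=> eB; elim=> {q x w q' y} [q x|q x w q1 m q2 y Hd _|q x a w q1 m q2 y Hd _].
- by exists [::]; split; [exact: tri_chain_nil|rewrite /= mulr1].
- case=> l [Hl ->]; have [l' [Hl' <-]] := tri_chain_step eB Hd.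
  by exists (l' ++ l); split; [exact: tri_chain_cat Hl' Hl|rewrite gprod_cat // mulA].
- case=> l [Hl ->]; have [l' [Hl' <-]] := tri_chain_step eB Hd.
  by exists (l' ++ l); split; [exact: tri_chain_cat Hl' Hl|rewrite gprod_cat // mulA].
Qed.

Lemma tri_chain_subset p l q n : tri_chain p l q n -> {subset l <= B}.
Proof.
elim=> {p l q n} // p b r l q n m _ _ hb _ _ IH y.
by rewrite inE => /predU1P[->|/IH].
Qed.

Lemma tri_chain_consE p b l q n : tri_chain p (b :: l) q n ->
  exists r n1 n2, [/\ p.2 \in U /\ r.2 \in U, b \in B, tri (p, b, r) n1,
    tri_chain r l q n2 & n = n1 + n2].
Proof. by move=> h; inversion h; subst; exists r, n0, m. Qed.

Lemma tri_chain_contract p l b b' l' q n : mul b b' \in B ->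
  tri_chain p (l ++ [:: b, b' & l']) q n -> tri_chain p (l ++ mul b b' :: l') q n.
Proof.
move=> hbb; elim: l p n => [|c l IH] p n /tri_chain_consE[r [n1 [n2]]] [[Up Ur] hb D].
  move=> /tri_chain_consE[r' [n3 [n4]]] [[_ Ur'] hb' D' h -> ->].
  rewrite addnA; apply: tri_chain_cons h => //.
  by apply: der_node (tri_split _ _ _ _ _) D D'; exact: tri_nontermP.
by move=> /IH h ->; exact: tri_chain_cons D h.
Qed.

(** Each contraction shortens the list and preserves its product. At most one factor remains in the
    end, and such a factor equals the product [e]; an empty chain has yield 0. *)
Lemma tri_chain_collapse p l q n : tri_chain p l q n -> gp l = e ->
  n = 0 \/ tri (p, e, q) n.
Proof.
have [k] := ubnP (size l); elim: k l => // k IH l lek Hl pl.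
case: (ltnP 1 (size l)) => [gt1|le1].
  have [l1 [b [b' [l2 [El hbb]]]]] := Bcontr (tri_chain_subset Hl) gt1 pl.
  subst l; apply: (IH (l1 ++ mul b b' :: l2)).
  - by move: lek; rewrite !size_cat /=; lia.
  - exact: tri_chain_contract.
  - by rewrite -[RHS]pl !gprod_cat //= !mulA.
case: l {lek} le1 Hl pl => [|b [|]] // _.
  by move=> h; inversion h; left.
move=> /tri_chain_consE[r [n1 [n2 [_ _ D h ->]]]].
by inversion h; subst; rewrite /= mulr1 addn0 => <-; right.
Qed.

Lemma unary_pumping_aux n : e \in B -> 2 ^ size tri_nonterm < n ->
  gaccepts mul A e (nseq n tt) ->
  exists k, 0 < k /\ forall t, gaccepts mul A e (nseq (n + t * k) tt).
Proof.
move=> eB ngt [qf [acc /(reaches_tri_chain eB)[l [Hl El]]]].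
rewrite size_nseq mul1 in Hl El.
case: (tri_chain_collapse Hl (esym El)) => [n0|D]; first by rewrite n0 in ngt.
have leaf1 x i : tri_leaf x i -> i <= 1 by case=> // ? [].
have [k [k0 Hk]] := pumping leaf1 D ngt; exists k; split=> // t.
exists qf; split=> //; have /= := tri_reaches (Hk t) e.
by rewrite !mulr1.
Qed.

End UnaryPumping.

Lemma In_mem (T : eqType) (x : T) s : List.In x s <-> x \in s.
Proof.
elim: s => //= y s [IH1 IH2]; rewrite inE; split.
  by case=> [->|/IH1 ->]; rewrite ?eqxx ?orbT.
by case/predU1P=> [->|/IH2]; [left|right].
Qed.

Lemma unary_pumping (T : eqType) (mul : T -> T -> T) e (B : seq T)
    (inG : T -> Prop) (L : seq unit -> Prop) :
  associative mul -> left_id e mul -> right_id e mul ->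
  contractible mul e B -> e \in B ->
  (forall x, inG x -> exists l, {subset l <= B} /\ gprod mul e l = x) ->
  in_frakL inG mul e L ->
  exists N, forall n, N < n -> L (nseq n tt) ->
  exists k, 0 < k /\ forall t, L (nseq (n + t * k) tt).
Proof.
move=> mulA mul1 mulr1 Bc eB Bgen [A [HA HL]].
pose tr := flatten [seq gdelta A q s | q <- enum (gstate A), s <- [:: None; Some tt]].
have [U [U0 Ucons Ufact]] : exists U : seq (seq T), [/\ [::] \in U,
    forall b u, b :: u \in U -> b \in B /\ u \in U &
    forall p, p \in tr -> exists u, u \in U /\ gprod mul e u = p.2].
  have : forall p, p \in tr -> inG p.2.
    by move=> p /flattenP[_ /allpairsP[[q a] [_ _ ->]] /In_mem /HA].
  elim: tr => [|p tr IH] htr.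
    by exists [:: [::]]; split=> // b u; rewrite inE.
  have [|U [U0 Uc Uf]] := IH; first by move=> p' hp'; apply: htr; rewrite inE hp' orbT.
  have [l [sl El]] := Bgen _ (htr p (mem_head _ _)).
  (* All suffixes of the chosen factorization [l], from [l] itself down to the empty word, keep [U]
     closed under tails. *)
  exists ([seq drop i l | i <- iota 0 (size l).+1] ++ U); split.
  - by rewrite mem_cat U0 orbT.
  - move=> b u; rewrite mem_cat => /orP[/mapP[i hi Ei]|/Uc[-> hu]]; last first.
      by rewrite mem_cat hu orbT.
    have lti : i < size l.
      by rewrite ltnNge; apply/negP => /drop_oversize Ed; rewrite Ed in Ei.
    move: Ei; rewrite (drop_nth b lti) => -[-> ->]; split; first exact/sl/mem_nth.
    by rewrite mem_cat; apply/orP; left; apply: (map_f (drop^~ l)); rewrite mem_iota; lia.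
  - move=> p' /predU1P[->|/Uf[u [hu Eu]]]; last by exists u; rewrite mem_cat hu orbT.
    exists l; split=> //; rewrite mem_cat; apply/orP; left.
    by apply/mapP; exists 0; rewrite ?drop0 // mem_iota.
exists (2 ^ size (tri_nonterm B A U)) => n ngt /HL Hn.
have [|k [k0 Hk]] := unary_pumping_aux mulA mul1 mulr1 Bc U0 Ucons _ eB ngt Hn.
  move=> q a q' m /In_mem Hd; apply: (Ufact (q', m)).
  apply/flattenP; exists (gdelta A q a) => //.
  by apply: allpairs_f; [rewrite mem_enum|case: (a) => [[]|]].
by exists k; split=> // t; apply/HL.
Qed.

(** * Alternating products in SL(2,Z) *)

Local Open Scope ring_scope.

(** The entries are listed row by row; products of concrete quadruples compute, and sign conditions
    become linear goals. *)
Notation mat2 := (int * int * int * int)%type.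
Definition mul2 (x y : mat2) : mat2 :=
  let: (a, b, c, d) := x in let: (a', b', c', d') := y in
  (a * a' + b * c', a * b' + b * d', c * a' + d * c', c * b' + d * d').
Definition one2 : mat2 := (1, 0, 0, 1).
Definition det2 (x : mat2) : int := let: (a, b, c, d) := x in a * d - b * c.

Lemma mul2A : associative mul2.
Proof.
move=> [[[a b] c] d] [[[a' b'] c'] d'] [[[a'' b''] c''] d''] /=.
by congr (_, _, _, _); ring.
Qed.

Lemma mul12 : left_id one2 mul2.
Proof. by move=> [[[a b] c] d] /=; congr (_, _, _, _); ring. Qed.

Lemma mul2_1 : right_id one2 mul2.
Proof. by move=> [[[a b] c] d] /=; congr (_, _, _, _); ring. Qed.

(** With S = (0,-1,1,0) and R = (0,-1,1,1), [elS] lists S and -S, and [elR] lists R, R^4, R^2, R^5,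
    since R^3 = -1. *)
Definition elS : seq mat2 := [:: (0, -1, 1, 0); (0, 1, -1, 0)].
Definition elR : seq mat2 :=
  [:: (0, -1, 1, 1); (0, 1, -1, -1); (-1, -1, 1, 0); (1, 1, -1, 0)].
Definition elB : seq mat2 := [:: one2, (-1, 0, 0, -1) & elS ++ elR].

(* With s in elS and r in elR, one of the first two clauses of [inP1]
   holds for the products s r ... s r and one of the last two for the products
   s r ... s; likewise [inP2] for r s ... r and r s ... r s. No clause holds for
   the identity. *)
Definition inP1 (x : mat2) : bool :=
  let: (a, b, c, d) := x in
     [|| [&& 0 < a, 0 <= b, 0 <= c, 0 < d & 0 < b + c],
         [&& a < 0, b <= 0, c <= 0, d < 0 & b + c < 0],
         [&& 0 <= a, b < 0, 0 < c & d <= 0] |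
         [&& a <= 0, 0 < b, c < 0 & 0 <= d]].

Definition inP2 (x : mat2) : bool :=
  let: (a, b, c, d) := x in
     [|| [&& a <= 0, b < 0, 0 < c, 0 <= d & 0 < d - a],
         [&& 0 <= a, 0 < b, c < 0, d <= 0 & d - a < 0],
         [&& a < 0, 0 <= b, 0 <= c, d < 0 & 0 < b + c] |
         [&& 0 < a, b <= 0, c <= 0, 0 < d & b + c < 0]].

Lemma elS_P1 s : s \in elS -> inP1 s.
Proof. by rewrite !inE => /orP[] /eqP -> /=; lia. Qed.

Lemma elR_P2 s : s \in elR -> inP2 s.
Proof. by rewrite !inE => /or4P[] /eqP -> /=; lia. Qed.

Lemma mul_elS_P1 s x : s \in elS -> inP2 x -> inP1 (mul2 s x).
Proof.
by case: x => [[[a b] c] d]; rewrite !inE => /orP[] /eqP -> /=; lia.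
Qed.

Lemma mul_elR_P2 s x : s \in elR -> inP1 x -> inP2 (mul2 s x).
Proof.
by case: x => [[[a b] c] d]; rewrite !inE => /or4P[] /eqP -> /=; lia.
Qed.

(** Two factors from the same cyclic group have their product in that group, and 1 and -1 belong to
    both groups. The 64 pairs are checked by computation. *)
Lemma elB_irreducible b b' : b \in elB -> b' \in elB -> mul2 b b' \notin elB ->
  (b \in elS) && (b' \in elR) || (b \in elR) && (b' \in elS).
Proof.
move=> hb hb'; apply/implyP.
have /allP/(_ _ hb)/allP/(_ _ hb') // : all (fun b => all (fun b' =>
    (mul2 b b' \notin elB) ==>
    ((b \in elS) && (b' \in elR) || (b \in elR) && (b' \in elS))) elB) elB.
by vm_compute.
Qed.

Lemma elS_elR b : b \in elS -> b \in elR -> False.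
Proof. by rewrite !inE => /orP[] /eqP ->. Qed.

(** Irreducible neighbours lie on opposite sides, so prepending a factor switches between the two
    sign patterns. A lone factor is excluded because it could be 1 or -1; with a neighbour it is
    forced into [elS] or [elR]. *)
Lemma alternating_inP b l : {subset b :: l <= elB} -> l != [::] ->
  path (fun b b' => mul2 b b' \notin elB) b l ->
  (b \in elS /\ inP1 (gprod mul2 one2 (b :: l))) \/
  (b \in elR /\ inP2 (gprod mul2 one2 (b :: l))).
Proof.
elim: l b => // b' l IH b sB _ /=/andP[irr hp].
have hb : b \in elB by apply: sB; rewrite inE eqxx.
have sB' : {subset b' :: l <= elB} by move=> y hy; apply: sB; rewrite inE hy orbT.
have hb' : b' \in elB by apply: sB'; rewrite inE eqxx.
have Htl : (b' \in elS /\ inP1 (gprod mul2 one2 (b' :: l))) \/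
    (b' \in elR /\ inP2 (gprod mul2 one2 (b' :: l))).
  case: (eqVneq l [::]) => [->|/IH]; last exact.
  rewrite /gprod /= mul2_1.
  by case/orP: (elB_irreducible hb hb' irr) => /andP[_ h]; [right|left];
    split=> //; [exact: elR_P2|exact: elS_P1].
case/orP: (elB_irreducible hb hb' irr) => /andP[h h']; [left|right]; split=> //;
  case: Htl => -[h'' HP]; try by case: (@elS_elR b').
- exact: mul_elS_P1.
- exact: mul_elR_P2.
Qed.

Lemma elB_contractible : contractible mul2 one2 elB.
Proof.
move=> [|b l] // sB sz hprod.
have lN0 : l != [::] by case: (l) sz.
suff /negP hN : ~ path (fun b b' => mul2 b b' \notin elB) b l.
  elim: l b {sB sz hprod lN0} hN => //= b' l IH b; rewrite negb_and negbK.
  case/orP => [h|/IH[l1 [c [c' [l2 [-> hc]]]]]]; first by exists [::], b, b', l.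
  by exists (b :: l1), c, c', l2.
by case/(alternating_inP sB lN0) => -[_]; rewrite hprod /=; lia.
Qed.

(** * Generation of SL(2,Z) *)

Definition generated (x : mat2) : Prop :=
  exists l, {subset l <= elB} /\ gprod mul2 one2 l = x.

Lemma generatedM x y : generated x -> generated y -> generated (mul2 x y).
Proof.
move=> [l [sl <-]] [l' [sl' <-]]; exists (l ++ l'); split.
  by move=> z; rewrite mem_cat => /orP[/sl|/sl'].
by rewrite gprod_cat //; [exact: mul2A|exact: mul12].
Qed.

Lemma generated_elB x : x \in elB -> generated x.
Proof.
move=> hx; exists [:: x]; split; last exact: mul2_1.
by move=> y; rewrite inE => /eqP ->.
Qed.

(** S^-1 R is the unit shear (1,1,0,1), and R^-1 S is its inverse. *)
Lemma generated_shear q : generated (1, q, 0, 1).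
Proof.
elim: q => [|q IH|q IH]; first exact: generated_elB.
- have := generatedM (generatedM (@generated_elB (0, 1, -1, 0) isT)
    (@generated_elB (0, -1, 1, 1) isT)) IH.
  by congr generated; rewrite /=; congr (_, _, _, _); lia.
- have := generatedM (generatedM (@generated_elB (1, 1, -1, 0) isT)
    (@generated_elB (0, -1, 1, 0) isT)) IH.
  by congr generated; rewrite /=; congr (_, _, _, _); lia.
Qed.

(** Euclid's algorithm on the first column, by descent on |c|: if a = qc + r, the matrix is the
    shear by q times S^-1 times a matrix with lower left entry r. If c = 0, then ad = 1 and the
    matrix is a shear up to sign. *)
Lemma det2_generated x : det2 x = 1 -> generated x.
Proof.
case: x => [[[a b] c] d]; have [n] := ubnP `|c|.
elim: n a b c d => // n IH a b c d lec /= hdet.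
case: (eqVneq c 0) => [c0|cN0].
  have : (a = 1 /\ d = 1) \/ (a = -1 /\ d = -1).
    have ad1 : a * d = 1 by rewrite -hdet c0; ring.
    have /eqP : (`|a| * `|d| = 1)%N by rewrite -abszM ad1.
    by rewrite muln_eq1 => /andP[/eqP ha /eqP hd]; nia.
  case=> -[ea ed]; first by rewrite c0 ea ed; exact: generated_shear.
  have := generatedM (@generated_elB (-1, 0, 0, -1) isT) (generated_shear (- b)).
  by congr generated; rewrite /= c0 ea ed; congr (_, _, _, _); lia.
have ea := divz_eq a c; have rge0 := modz_ge0 a cN0; have rltc := ltz_mod a cN0.
set q := (a %/ c)%Z in ea; set r := (a %% c)%Z in ea rge0 rltc.
have h : generated (-c, -d, r, b - q * d).
  by apply: IH; [lia|rewrite /= -hdet ea; ring].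
have := generatedM (generated_shear q)
  (generatedM (@generated_elB (0, 1, -1, 0) isT) h).
by congr generated; rewrite /=; congr (_, _, _, _); rewrite ?ea; ring.
Qed.

(** * From matrices to quadruples, and from SL(2,Z) into SL(3,Z) *)

Definition mat2_of_mx (M : 'M[int]_2) : mat2 := (M 0 0, M 0 1, M 1 0, M 1 1).

Lemma mat2_of_mx_inj : injective mat2_of_mx.
Proof.
move=> M N [h00 h01 h10 h11]; apply/matrixP => i j.
by case: i => [[|[|]]] // hi; case: j => [[|[|]]] // hj;
  [move: h00|move: h01|move: h10|move: h11];
  congr (_ = _); congr fun_of_matrix; exact: val_inj.
Qed.

Lemma mat2_of_mxM M N : mat2_of_mx (M *m N) = mul2 (mat2_of_mx M) (mat2_of_mx N).
Proof.
by rewrite /mat2_of_mx /= !mxE !big_ord_recr !big_ord0 /= !add0r;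
  congr (_, _, _, _); congr (_ * _ + _ * _); congr fun_of_matrix; exact: val_inj.
Qed.

Lemma det2_mat2_of_mx M : det2 (mat2_of_mx M) = \det M.
Proof.
rewrite /= (expand_det_row _ 0) !big_ord_recr big_ord0 /= add0r /cofactor.
rewrite !det_mx11 !mxE /= expr0 expr1.
rewrite mul1r mulN1r mulrN.
by congr (_ * _ - _ * _); congr fun_of_matrix; exact: val_inj.
Qed.

Lemma frakL_SL2_unary_pumping (L : seq unit -> Prop) : in_frakL_SL 2 L ->
  exists N, forall n, (N < n)%N -> L (nseq n tt) ->
  exists k, (0 < k)%N /\ forall t, L (nseq (n + t * k) tt).
Proof.
move=> HL; apply: (unary_pumping mul2A mul12 mul2_1 elB_contractible _
  (inG := fun x => det2 x = 1) det2_generated) => //.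
apply: in_frakL_morph mat2_of_mx_inj mat2_of_mxM _ _ HL.
  by rewrite /mat2_of_mx !mxE.
by move=> M; rewrite det2_mat2_of_mx.
Qed.

Lemma in_frakL_SL_2_3 (Sigma : finType) (L : seq Sigma -> Prop) :
  in_frakL_SL 2 L -> in_frakL_SL 3 L.
Proof.
(* The dimension is written [2 + 1], convertible to 3, so that block matrix lemmas apply. *)
pose phi (M : 'M[int]_2) : 'M[int]_(2 + 1) := block_mx M 0 0 1%:M.
apply: (@in_frakL_morph _ _ _ _ _ _ _ _ phi) => [M N|M N| |M].
- by rewrite /phi => /eq_block_mx[].
- have := mulmx_block M 0 0 (1%:M : 'M[int]_1) N 0 0 1%:M.
  by rewrite !mulmx0 !mul0mx !addr0 !add0r mulmx1 => /esym.
- by rewrite /phi -scalar_mx_block.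
- by rewrite /inSL => HM; have := det_ublock M 0 (1%:M : 'M[int]_1); rewrite det1 mulr1 HM.
Qed.

(** * The triangular numbers in SL(3,Z) *)

Definition heis (x y z : int) : 'M[int]_3 :=
  \matrix_(i, j) nth 0 (nth [::] [:: [:: 1; x; z]; [:: 0; 1; y]; [:: 0; 0; 1]] i) j.

Lemma heisM x y z x' y' z' :
  heis x y z *m heis x' y' z' = heis (x + x') (y + y') (z + z' + x * y').
Proof.
apply/matrixP => i j; rewrite !mxE !big_ord_recr big_ord0 /= !mxE.
by case: i => [[|[|[|]]]] // ?; case: j => [[|[|[|]]]] // ? /=; ring.
Qed.

Lemma heis1 : heis 0 0 0 = 1%:M.
Proof.
by apply/matrixP => i j; rewrite !mxE; case: i => [[|[|[|]]]] // ?;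
  case: j => [[|[|[|]]]].
Qed.

Lemma heis_inj x y z x' y' z' : heis x y z = heis x' y' z' ->
  [/\ x = x', y = y' & z = z'].
Proof.
move=> /matrixP h; split.
- by have := h 0 1; rewrite !mxE.
- by have := h 1 ord_max; rewrite !mxE.
- by have := h 0 ord_max; rewrite !mxE.
Qed.

Lemma heis_SL x y z : inSL (heis x y z).
Proof.
rewrite /inSL -det_tr det_trig; last first.
  apply/is_trig_mxP => i j; rewrite !mxE.
  by case: i => [[|[|[|]]]] // ?; case: j => [[|[|[|]]]].
by rewrite !big_ord_recr big_ord0 /= !mxE.
Qed.

(** State 0 multiplies by J; state 1 lowers x silently and lowers z at each letter, in any order
    since E12 and E13 commute; state 2 lowers y. Moves by [heis 0 0 0] only change the state. *)
Definition triangular_delta (q : 'I_3) (s : option unit) : seq ('I_3 * 'M[int]_3) :=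
  match val q, s with
  | 0%N, None => [:: (0, heis 1 1 0); (1, heis 0 0 0)]
  | 1%N, None => [:: (1, heis (-1) 0 0); (ord_max, heis 0 0 0)]
  | 1%N, Some _ => [:: (1, heis 0 0 (-1))]
  | 2%N, None => [:: (ord_max, heis 0 (-1) 0)]
  | _, _ => [::]
  end.

Definition triangular_aut : gaut 'M[int]_3 unit :=
  @GAut _ _ 'I_3 triangular_delta 0 (fun q => val q == 2%N).

(** The invariant describes what is left of an accepting run. In state 0, [i] counts the remaining
    factors J, which add x, x+1, ..., x+i-1 to z, and [j] is the value of x on leaving; in state 1,
    [i] counts the remaining factors E12^-1. *)
Lemma triangular_sound (q : 'I_3) g (w : seq unit) (q' : 'I_3) g' :
  @reaches _ mulmx _ triangular_aut q g w q' g' -> val q' = 2%N ->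
  g' = 1%:M -> forall x y z, g = heis x y z ->
  exists i j : nat, match val q with
  | 0%N => x + i%:Z = j%:Z /\ z + x * i%:Z + 'C(i, 2)%:Z = (size w)%:Z
  | 1%N => x = i%:Z /\ z = (size w)%:Z
  | _ => [/\ x = 0, z = 0 & w = [::]]
  end.
Proof.
elim=> {q g w q' g'}
  [q g|q g w q1 m q2 g2 Hd _ IH|q g a w q1 m q2 g2 Hd _ IH] q2E g2E x y z gE.
- rewrite q2E; exists 0%N, 0%N; move: g2E; rewrite gE -heis1.
  by case/heis_inj.
- have {}IH := IH q2E g2E.
  case: q Hd => [[|[|[|]]]] //= hq.
  + case=> [[? ?]|[[? ?]|//]]; subst q1 m g.
    * have [i [j /= []]] := IH _ _ _ (heisM _ _ _ _ _ _).
      by exists i.+1, j; rewrite binS bin1; split; lia.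
    * have [i [j /= []]] := IH _ _ _ (heisM _ _ _ _ _ _).
      by exists 0%N, i; rewrite bin0n; split; lia.
  + case=> [[? ?]|[[? ?]|//]]; subst q1 m g.
    * have [i [j /= []]] := IH _ _ _ (heisM _ _ _ _ _ _).
      by exists i.+1, j; split; lia.
    * have := IH _ _ _ (heisM _ _ _ _ _ _); rewrite /= => -[i [j [? ? ->]]].
      by exists 0%N, 0%N; rewrite /=; split; lia.
  + case=> [[? ?]|//]; subst q1 m g.
    have := IH _ _ _ (heisM _ _ _ _ _ _); rewrite /= => -[i [j [? ? ->]]].
    by exists 0%N, 0%N; split=> //; lia.
- have {}IH := IH q2E g2E.
  case: q Hd => [[|[|[|]]]] //= hq [[? ?]|//]; subst q1 m g.
  have [i [j /= []]] := IH _ _ _ (heisM _ _ _ _ _ _).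
  by exists i, j; split; lia.
Qed.

Lemma triangular_complete k :
  gaccepts mulmx triangular_aut 1%:M (nseq 'C(k, 2) tt).
Proof.
exists ord_max; split; first by [].
have step0 i : @reaches _ mulmx _ triangular_aut 0 1%:M [::] 0
    (heis i%:Z i%:Z 'C(i, 2)%:Z).
  elim: i => [|i IH]; first by rewrite heis1; exact: reaches_nil.
  apply: (reaches_cat (v := [::]) IH).
  apply: (@reaches_eps _ _ _ triangular_aut _ _ _ 0 (heis 1 1 0)); first by left.
  rewrite heisM binS bin1.
  have -> : heis (i%:Z + 1) (i%:Z + 1) ('C(i, 2)%:Z + 0 + i%:Z * 1) =
    heis i.+1%:Z i.+1%:Z ('C(i, 2) + i)%N%:Z by congr heis; lia.
  exact: reaches_nil.
have step01 x y z : @reaches _ mulmx _ triangular_aut 0 (heis x y z) [::] 1 (heis x y z).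
  apply: (@reaches_eps _ _ _ triangular_aut _ _ _ 1 (heis 0 0 0)); first by right; left.
  by rewrite heis1 mulmx1; exact: reaches_nil.
have step1 i y z : @reaches _ mulmx _ triangular_aut 1 (heis i%:Z y z) [::] 1 (heis 0 y z).
  elim: i => [|i IH]; first exact: reaches_nil.
  apply: (@reaches_eps _ _ _ triangular_aut _ _ _ 1 (heis (-1) 0 0)); first by left.
  rewrite heisM; move: IH; congr (reaches _ _ _ _ _ _); congr heis; lia.
have read1 y n : @reaches _ mulmx _ triangular_aut 1 (heis 0 y n%:Z) (nseq n tt)
    1 (heis 0 y 0).
  elim: n => [|n IH]; first exact: reaches_nil.
  apply: (@reaches_read _ _ _ triangular_aut _ _ _ _ 1 (heis 0 0 (-1))); first by left.
  rewrite heisM; move: IH; congr (reaches _ _ _ _ _ _); congr heis; lia.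
have step12 g : @reaches _ mulmx _ triangular_aut 1 g [::] ord_max g.
  apply: (@reaches_eps _ _ _ triangular_aut _ _ _ ord_max (heis 0 0 0));
    first by right; left.
  by rewrite heis1 mulmx1; exact: reaches_nil.
have step2 i : @reaches _ mulmx _ triangular_aut ord_max (heis 0 i%:Z 0) [::]
    ord_max 1%:M.
  elim: i => [|i IH]; first by rewrite heis1; exact: reaches_nil.
  apply: (@reaches_eps _ _ _ triangular_aut _ _ _ ord_max (heis 0 (-1) 0)).
    by left.
  rewrite heisM; move: IH; congr (reaches _ _ _ _ _ _); congr heis; lia.
rewrite -(cats0 (nseq _ _)).
apply: (reaches_cat (v := [::])) (step0 k) _.
apply: (reaches_cat (v := [::])) (step01 _ _ _) _.
apply: (reaches_cat (v := [::])) (step1 _ _ _) _.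
apply: reaches_cat (read1 _ _) _.
exact: (reaches_cat (v := [::])) (step12 _) (step2 k).
Qed.

Lemma triangular_acceptsE w : gaccepts mulmx triangular_aut 1%:M w <->
  exists k, size w = 'C(k, 2).
Proof.
split=> [[qf [/eqP qfE h]]|[k Hk]].
  have [k [j /= [_ H]]] := triangular_sound h qfE erefl (esym heis1).
  by exists k; lia.
have -> : w = nseq 'C(k, 2) tt by rewrite -Hk; elim: w {Hk} => //= -[] w {1}->.
exact: triangular_complete.
Qed.

Definition triangular_lang (w : seq unit) : Prop := exists k, size w = 'C(k, 2).

Lemma triangular_lang_SL3 : in_frakL_SL 3 triangular_lang.
Proof.
exists triangular_aut; split; last by move=> w; rewrite triangular_acceptsE.
move=> [[|[|[|]]]] // hq [[]|] p //=; rewrite /= => H;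
  by repeat case: H => [<-|H] //; exact: heis_SL.
Qed.

(** C(j,2) and C(j+1,2) differ by j, so if C(j,2) lies in a progression of step k < j, the next term
    falls strictly between them. *)
Lemma triangular_lang_not_SL2 : ~ in_frakL_SL 2 triangular_lang.
Proof.
(* The index N + 3 makes C(N+3,2) exceed N. *)
case/frakL_SL2_unary_pumping => N /(_ 'C(N.+3, 2)); case.
- by rewrite bin2; nia.
- by exists N.+3; rewrite size_nseq.
move=> k [k_gt0 Hk].
have [j jk [t Ht]] : exists2 j, (k < j)%N &
    exists t, 'C(j, 2) = ('C(N.+3, 2) + t * k)%N.
  (* The term with t = k is at least k^2 plus a positive number, hence above C(k,2); this forces j >
     k. *)
  have [j] := Hk k; rewrite size_nseq => /esym Hj; exists j; last by exists k.
  rewrite ltnNge; apply/negP => /(leq_bin2l 2); rewrite Hj [X in (_ <= X)%N]bin2.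
  have : (k * k.-1 <= k * k)%N by rewrite leq_mul2l leq_pred orbT.
  by lia.
have [i] := Hk t.+1; rewrite size_nseq mulSn addnCA -Ht => Hi.
have /(leq_bin2l 2) : (j.+1 <= i)%N.
  by rewrite ltnNge; apply/negP => /(leq_bin2l 2); lia.
by rewrite binS bin1; lia.
Qed.

(* frak L(SL(2,Z)) is a strict subclass of frak L(SL(3,Z)). *)
Theorem theorem3p8 :
  (forall (Sigma : finType) (L : seq Sigma -> Prop),
      in_frakL_SL 2 L -> in_frakL_SL 3 L) /\
  (exists (Sigma : finType) (L : seq Sigma -> Prop),
      in_frakL_SL 3 L /\ ~ in_frakL_SL 2 L).
Proof.
split; first exact: in_frakL_SL_2_3.
by exists unit, triangular_lang; split;
  [exact: triangular_lang_SL3|exact: triangular_lang_not_SL2].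
Qed.
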